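(* Let $q\in(1,\infty]$ and $w\in RH_q^+$. Then there exist $\nu\in(0,\frac14)$ and $\Theta,C\in(0,\infty)$, all depending only on $n$, $p$, $q$, and $[w]_{RH_q^+}$, such that, for any $\gamma\in[0,\frac12]$, $R\in\mathcal{R}$, $i\in\{1,\dots,n\}$, and $\sigma\in\{-1,1\}$, $$w\left(R^-(\gamma)\right)\leq C\,w\left(R^-(\gamma)+\left(\sigma\nu\, l(R)e_i,\ \Theta[l(R)]^p\right)\right).$$
   Context: Work in $\mathbb{R}^{n+1}$, with points $(x,t)$, $x\in\mathbb{R}^n$, $t\in\mathbb{R}$; $p\in(1,\infty)$ is fixed throughout. $Q(x,L)=\{y\in\mathbb{R}^n: x_i-\frac L2\le y_i<x_i+\frac L2 \text{ for all } i\in\{1,\dots,n\}\}$. A parabolic rectangle centered at $(x,t)$ with edge length $l(R):=L\in(0,\infty)$ is $R=R(x,t,L)=Q(x,L)\times[t-L^p,t+L^p)$; $\mathcal{R}$ is the set of all parabolic rectangles. For $\gamma\in[0,1)$, $R^-(\gamma)=Q(x,L)\times[t-L^p,t-\gamma L^p)$ and $R^+(\gamma)=Q(x,L)\times[t+\gamma L^p,t+L^p)$. $\fint_A f=\frac1{|A|}\int_A f$. A weight is a nonnegative locally integrable function on $\mathbb{R}^{n+1}$ that is positive almost everywhere; $w(A)=\int_A w$. For $A\subset\mathbb{R}^{n+1}$ and $(x,t)\in\mathbb{R}^{n+1}$, $A+(x,t)=\{(y+x,s+t):(y,s)\in A\}$. $e_i$ is the unit vector of $\mathbb{R}^n$ in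 the $i$-th coordinate direction. For $q\in(1,\infty]$, $RH_q^+$ is the set of all weights $w$ with $[w]_{RH_q^+}<\infty$, where $[w]_{RH_q^+}=\sup_{R\in\mathcal{R}}\big[\fint_{R^-(0)}w^q\big]^{\frac1q}\big[\fint_{R^+(0)}w\big]^{-1}$ for $q\in(1,\infty)$ and $[w]_{RH_\infty^+}=\sup_{R\in\mathcal{R}}[\operatorname{ess\,sup}_{R^-(0)}w]\big[\fint_{R^+(0)}w\big]^{-1}$. *)

(* Defs.v *)
From HB Require Import structures.
From mathcomp Require Import all_boot all_order all_algebra.
From mathcomp Require Import all_classical all_reals all_analysis.

Set Implicit Arguments.
Unset Strict Implicit.
Unset Printing Implicit Defensive.

Import Order.TTheory GRing.Theory Num.Theory.
Import numFieldNormedType.Exports.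

Local Open Scope classical_set_scope.
Local Open Scope ring_scope.

Definition measure_rV_display : measure_display.
Proof. exact: default_measure_display. Qed.

Section measurable_rV.
Context {R : realType} (n : nat).

Let coors (i : 'I_n) (x : 'rV[R]_n) : R := x ord0 i.

Let rV_set0 : g_sigma_preimage coors set0.
Proof. exact: sigma_algebra0. Qed.

Let rV_setC A : g_sigma_preimage coors A -> g_sigma_preimage coors (~` A).
Proof. exact: sigma_algebraC. Qed.

Let rV_bigcup (F : _^nat) : (forall i, g_sigma_preimage coors (F i)) ->
  g_sigma_preimage coors (\bigcup_i (F i)).
Proof. exact: sigma_algebra_bigcup. Qed.

HB.instance Definition _ := @isMeasurable.Build measure_rV_display
  'rV[R]_n (g_sigma_preimage coors) rV_set0 rV_setC rV_bigcup.

End measurable_rV.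

Section measurable_rV_lemmas.
Context {R : realType}.

Lemma measurable_coor n (i : 'I_n) :
  measurable_fun [set: 'rV[R]_n] (fun x : 'rV[R]_n => x ord0 i).
Proof.
move=> _ Y mY; rewrite setTI; apply: sub_sigma_algebra => /=.
rewrite -bigcup_seq/=; exists i => /=; first by rewrite mem_index_enum.
by exists Y => //; rewrite setTI.
Qed.

Lemma measurable_fun_rV d (T : measurableType d) n (f : T -> 'rV[R]_n) :
  (forall i, measurable_fun [set: T] (fun x => f x ord0 i)) ->
  measurable_fun [set: T] f.
Proof.
move=> mf _ A mA.
have: preimage_set_system [set: T] f
    (g_sigma_preimage (fun i (x : 'rV[R]_n) => x ord0 i)) ([set: T] `&` f @^-1` A).
  by exists A.
rewrite -g_sigma_preimage_comp; apply: smallest_sub.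
  exact: sigma_algebra_measurable.
rewrite -bigcup_seq; apply: bigcup_sub => i _ B [C mC <-].
exact: mf.
Qed.

Definition cons_rV n (z : R * 'rV[R]_n) : 'rV[R]_n.+1 :=
  row_mx (const_mx z.1 : 'rV[R]_1) z.2.

Lemma cons_rV0 n (z : R * 'rV[R]_n) : cons_rV z ord0 ord0 = z.1.
Proof.
have -> : (ord0 : 'I_n.+1) = @lshift 1 n ord0 by exact/val_inj.
by rewrite [LHS]row_mxEl mxE.
Qed.

Lemma cons_rVS n (z : R * 'rV[R]_n) (i : 'I_n) :
  cons_rV z ord0 (lift ord0 i) = z.2 ord0 i.
Proof.
have -> : (lift ord0 i : 'I_n.+1) = @rshift 1 n i by exact/val_inj.
by rewrite [LHS]row_mxEr.
Qed.

Lemma measurable_cons_rV n :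
  measurable_fun [set: R * 'rV[R]_n] (@cons_rV n).
Proof.
apply: measurable_fun_rV => i; have [j ->|->] := unliftP ord0 i.
  under eq_fun do rewrite cons_rVS.
  exact: (measurableT_comp (measurable_coor j) measurable_snd).
under eq_fun do rewrite cons_rV0.
exact: measurable_fst.
Qed.

Definition uncons_rV n (y : 'rV[R]_n.+1) : R * 'rV[R]_n :=
  (y ord0 ord0, \row_i y ord0 (lift ord0 i)).

Lemma measurable_uncons_rV n :
  measurable_fun [set: 'rV[R]_n.+1] (@uncons_rV n).
Proof.
apply: measurable_fun_pair; first exact: measurable_coor.
apply: measurable_fun_rV => i.
rewrite (_ : (fun _ => _) = (fun y : 'rV[R]_n.+1 => y ord0 (lift ord0 i))).
  exact: measurable_coor.
by apply/funext => y /=; rewrite mxE.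
Qed.

Lemma cons_rVK n : cancel (@cons_rV n) (@uncons_rV n).
Proof.
move=> [x y]; rewrite /uncons_rV cons_rV0; congr pair.
by apply/rowP => i; rewrite mxE cons_rVS.
Qed.

End measurable_rV_lemmas.

Section lebesgue_cons.
Local Open Scope ereal_scope.
Context {R : realType} (n : nat).
Variable mu : {sigma_finite_measure set 'rV[R]_n -> \bar R}.

Definition lebesgue_cons : set 'rV[R]_n.+1 -> \bar R :=
  pushforward ((@lebesgue_measure R) \x mu) (@cons_rV R n).

Let lebesgue_cons0 : lebesgue_cons set0 = 0.
Proof. by rewrite /lebesgue_cons /pushforward preimage_set0 measure0. Qed.

Let lebesgue_cons_ge0 A : 0 <= lebesgue_cons A.
Proof. by rewrite /lebesgue_cons /pushforward measure_ge0. Qed.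

Let lebesgue_cons_sigma_additive : semi_sigma_additive lebesgue_cons.
Proof.
move=> F mF tF mUF; rewrite /lebesgue_cons /pushforward preimage_bigcup.
apply: measure_semi_sigma_additive.
- move=> k; rewrite -[X in measurable X]setTI.
  exact: measurable_cons_rV.
- apply/trivIsetP => /= i j _ _ ij; rewrite -preimage_setI.
  by move/trivIsetP : tF => /(_ _ _ _ _ ij) ->//; rewrite preimage_set0.
- rewrite -preimage_bigcup -[X in measurable X]setTI.
  exact: measurable_cons_rV.
Qed.

HB.instance Definition _ := isMeasure.Build _ _ _ lebesgue_cons
  lebesgue_cons0 lebesgue_cons_ge0 lebesgue_cons_sigma_additive.

Let lebesgue_cons_sigma_finite : sigma_finite setT lebesgue_cons.
Proof.
have /sigma_finiteP[F [TF ndF Foo]] := sigma_finiteT (@lebesgue_measure R).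
have /sigma_finiteP[G [TG ndG Goo]] := sigma_finiteT mu.
exists (fun k => @uncons_rV R n @^-1` (F k `*` G k)).
  apply/esym; rewrite -subTset => y _.
  have [k _ Fk] : (\bigcup_k F k) (uncons_rV y).1 by rewrite -TF.
  have [l _ Gl] : (\bigcup_k G k) (uncons_rV y).2 by rewrite -TG.
  exists (maxn k l) => //; split => /=.
    by move: Fk; exact/subsetPset/ndF/leq_maxl.
  by move: Gl; exact/subsetPset/ndG/leq_maxr.
move=> k; have [mF Fkoo] := Foo k; have [mG Gkoo] := Goo k; split.
  rewrite -[X in measurable X]setTI; apply: measurable_uncons_rV => //.
  exact: measurableX.
rewrite /lebesgue_cons /pushforward -comp_preimage.
rewrite (_ : _ \o _ = id); last by apply/funext => z; exact: cons_rVK.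
by rewrite preimage_id product_measure1E// lte_mul_pinfty// ge0_fin_numE.
Qed.

HB.instance Definition _ := Measure_isSigmaFinite.Build _ _ _ lebesgue_cons
  lebesgue_cons_sigma_finite.

End lebesgue_cons.

(* n-dimensional Lebesgue measure on the Borel sets, as the iterated product of
   the one-dimensional one. *)
Fixpoint lebesgue_rV (R : realType) (n : nat) :
    {sigma_finite_measure set 'rV[R]_n -> \bar R} :=
  match n with
  | 0 => \d_ (0 : 'rV[R]_0)
  | m.+1 => lebesgue_cons (lebesgue_rV R m)
  end.

Lemma lebesgue_rV_box (R : realType) (n : nat) (a b : 'rV[R]_n) :
  (forall i, a ord0 i <= b ord0 i) ->
  lebesgue_rV R n [set y | forall i, a ord0 i <= y ord0 i < b ord0 i] =
  (\prod_(i < n) (b ord0 i - a ord0 i))%:E.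
Proof.
elim: n a b => [|n IH] a b ab.
  by rewrite big_ord0 /= diracE mem_set// => -[].
rewrite big_ord_recl /= /lebesgue_cons /pushforward.
pose a' := (@uncons_rV R n a).2; pose b' := (@uncons_rV R n b).2.
set B := [set y : 'rV[R]_n | forall i, a' ord0 i <= y ord0 i < b' ord0 i].
rewrite (_ : _ @^-1` _ =
    [set` `[a ord0 ord0, b ord0 ord0[%R] `*` B); last first.
  apply/seteqP; split => -[x y] /=.
    move=> h; split => [|i] /=.
      by rewrite in_itv /=; have := h ord0; rewrite cons_rV0.
    by have := h (lift ord0 i); rewrite cons_rVS /= !mxE.
  rewrite in_itv /= => -[xab yB] i; have [j ->|->] := unliftP ord0 i.
    by rewrite cons_rVS; have := yB j; rewrite !mxE.
  by rewrite cons_rV0.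
rewrite product_measure1E//; last first.
  rewrite (_ : B = \bigcap_(i in [set: 'I_n])
      [set y : 'rV[R]_n | y ord0 i \in `[a' ord0 i, b' ord0 i[%R]); last first.
    apply/seteqP; split => y /= h i; last by have := h i I; rewrite /= in_itv.
    by move=> _; rewrite /= in_itv; exact: h.
  apply: fin_bigcap_measurable => // i _.
  rewrite -[X in measurable X]setTI.
  exact: (measurable_coor i measurableT (measurable_itv _)).
have ab' i : a' ord0 i <= b' ord0 i by rewrite !mxE.
rewrite IH//.
rewrite [X in (X * _)%E = _]lebesgue_measure_itv /= lte_fin.
under eq_bigr do rewrite !mxE.
case: ltP => [_|ba]; first by rewrite -EFinD -EFinM.
have -> : a ord0 ord0 = b ord0 ord0 by apply/eqP; rewrite eq_le ab ba.
by rewrite subrr mul0r mul0e.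
Qed.

Notation spacetime R n := ('rV[R]_n * R)%type.

(* The Carathéodory extension makes all Lebesgue measurable sets of R^(n+1)
   measurable, not only the Borel ones. *)
Definition lebesgue_st (R : realType) (n : nat) :=
  @completed_measure_extension _ _ _ (lebesgue_rV R n \x @lebesgue_measure R)%E.
Arguments lebesgue_st : clear implicits.

HB.instance Definition _ (R : realType) (n : nat) :=
  Measure.on (@lebesgue_st R n).

Section means.
Local Open Scope ereal_scope.
Context {R : realType} {n : nat}.
Implicit Types (A : set (spacetime R n)) (w : spacetime R n -> R).

Local Notation mu := (lebesgue_st R n).

Definition wint w A : \bar R := \int[mu]_(z in A) (w z)%:E.

Definition mean w A : \bar R := (mu A)^-1 * wint w A.

(* The library's [ess_sup] ranges over the whole space. *)
Definition ess_sup_on w A : \bar R :=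
  ereal_inf [set y | {ae mu, forall z, A z -> (w z)%:E <= y}].

(* Only used for 1 < q <= +oo; the value at -oo is a dummy. *)
Definition q_mean (q : \bar R) w A : \bar R :=
  match q with
  | r%:E => poweR (mean (fun z => w z `^ r)%R A) r^-1
  | +oo => ess_sup_on w A
  | -oo => 0
  end.

Record is_weight w : Prop := IsWeight {
  weight_measurable : measurable_fun
    [set: caratheodory_type (mu_ext (lebesgue_rV R n \x @lebesgue_measure R))]
    w ;
  weight_ge0 : forall z, (0 <= w z)%R ;
  weight_locally_integrable :
    forall K : set (spacetime R n), compact K -> wint w K < +oo ;
  weight_ae_gt0 : {ae mu, forall z, (0 < w z)%R} }.

End means.

Record parabolic_rectangle (R : realType) (n : nat) := ParabolicRectangle {
  pcenter : 'rV[R]_n ;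
  ptime : R ;
  pedge : R ;
  pedge_gt0 : 0 < pedge }.

Section reverse_holder.
Context {R : realType} {n : nat}.
Implicit Types (P : parabolic_rectangle R n) (A : set (spacetime R n))
  (w : spacetime R n -> R).

Definition cube (x : 'rV[R]_n) (L : R) : set 'rV[R]_n :=
  [set y | forall i, x ord0 i - L / 2 <= y ord0 i < x ord0 i + L / 2].

Definition lower (p gamma : R) P : set (spacetime R n) :=
  cube (pcenter P) (pedge P) `*`
  [set` `[ptime P - pedge P `^ p, ptime P - gamma * pedge P `^ p[].

Definition upper (p gamma : R) P : set (spacetime R n) :=
  cube (pcenter P) (pedge P) `*`
  [set` `[ptime P + gamma * pedge P `^ p, ptime P + pedge P `^ p[].

Definition translate A (v : spacetime R n) : set (spacetime R n) :=
  [set z + v | z in A].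

Definition RHplus_const (p : R) (q : \bar R) w : \bar R :=
  ereal_sup [set (q_mean q w (lower p 0 P) * (mean w (upper p 0 P))^-1)%E
            | P in [set: parabolic_rectangle R n]].

Definition RHplus (p : R) (q : \bar R) : set (spacetime R n -> R) :=
  [set w | is_weight w /\ (RHplus_const p q w < +oo)%E].

End reverse_holder.

(* Main.v *)
Require Import Defs.
From mathcomp Require Import all_boot all_order all_algebra.
From mathcomp Require Import all_classical all_reals all_analysis.
From mathcomp Require Import measurable_realfun ring lra.
Import Order.TTheory GRing.Theory Num.Theory.
Import numFieldNormedType.Exports.
Local Open Scope classical_set_scope.
Local Open Scope ring_scope.

(* The reverse Hoelder inequality bounds the mass of a thin slab of a cube, of
   relative width 1/A, by a quarter of the mass of the whole cube one time step
   later.  Cutting that cube into A slabs, the mass m of the slab satisfies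
   2 m <= 2^j m_j for some slab m_j lying j positions further along, so either
   the mass has moved or it has doubled.  At edge length l = L/2^m make N 2^m
   such steps: as long as the total displacement is below L/8, at most A 2^m
   positions have been lost, so the mass has grown by a factor exponential in
   2^m, which also pays for passing to a slab of half the size.  The time spent
   at this scale is N 2^m l^p, which is summable since p > 1.  If the mass never
   travelled by L/8 it would become unbounded in finite time, contradicting
   local integrability.  Once it has, doubling forward in time on cubes of edge
   L/4 carries it into the translated rectangle. *)

(** * Boxes in space-time *)

(** Recorded by lower corner, edge vector and starting time, so that cubes, slabs thin in one
    direction, halves of parabolic rectangles and translates all have the same form. *)
Definition box {R : realType} {n : nat} (x e : 'rV[R]_n) (t h : R) :
    set (spacetime R n) :=
  [set y : 'rV[R]_n | forall j, x ord0 j <= y ord0 j < x ord0 j + e ord0 j] `*`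
  [set` `[t, t + h[].

(** The plain product type carries the product sigma-algebra; this alias selects the Carathéodory
    one, on which the completed measure and the weight are measurable. *)
Notation lebesgue_type R n :=
  (caratheodory_type (mu_ext (lebesgue_rV R n \x @lebesgue_measure R)%E)).

Notation lebesgue_measurable R n :=
  (measurable : set (set (lebesgue_type R n))).

Section box_measure.
Context {R : realType} {n : nat}.
Implicit Types (x e : 'rV[R]_n) (t h : R).

Lemma measurable_rV_itvs (I : 'I_n -> interval R) :
  measurable [set y : 'rV[R]_n | forall j, y ord0 j \in I j].
Proof.
rewrite (_ : [set y | _] = \bigcap_(j in [set: 'I_n])
    [set y : 'rV[R]_n | y ord0 j \in I j]); last first.
  by apply/seteqP; split => y /= h j; [move=> _; exact: h|exact: h].
apply: fin_bigcap_measurable => // j _.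
rewrite -[X in measurable X]setTI.
exact: (measurable_coor j measurableT (measurable_itv _)).
Qed.

Lemma measurable_rV_box x e :
  measurable [set y : 'rV[R]_n | forall j,
    x ord0 j <= y ord0 j < x ord0 j + e ord0 j].
Proof.
rewrite (_ : [set y | _] = [set y : 'rV[R]_n | forall j,
    y ord0 j \in `[x ord0 j, (x ord0 j + e ord0 j)%R[ ]).
  exact: measurable_rV_itvs.
by apply/seteqP; split => y /= h j; have := h j; rewrite in_itv.
Qed.

Lemma measurable_box x e t h : lebesgue_measurable R n (box x e t h).
Proof.
apply: caratheodory_measurable_mu_ext; apply: measurableX.
  exact: measurable_rV_box.
exact: measurable_itv.
Qed.

Lemma lebesgue_st_box x e t h : (forall j, 0 <= e ord0 j) -> 0 <= h ->
  lebesgue_st R n (box x e t h) = (\prod_j e ord0 j * h)%:E.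
Proof.
move=> e0 h0.
rewrite /lebesgue_st /completed_measure_extension/=.
rewrite measurable_mu_extE; last first.
  by apply: measurableX; [exact: measurable_rV_box|exact: measurable_itv].
rewrite [LHS](product_measure1E (lebesgue_rV R n) lebesgue_measure
  (measurable_rV_box x e) (measurable_itv _)).
rewrite EFinM; congr (_ * _)%E.
  transitivity (lebesgue_rV R n [set y : 'rV[R]_n | forall j,
      x ord0 j <= y ord0 j < (x + e) ord0 j]).
    by congr (lebesgue_rV R n _); apply/seteqP; split => y /= H j;
      have := H j; rewrite mxE.
  rewrite lebesgue_rV_box; last by move=> j; rewrite mxE lerDl.
  by congr EFin; apply: eq_bigr => j _; rewrite mxE addrAC subrr add0r.
rewrite [LHS]lebesgue_measure_itv /= lte_fin ltrDl; case: ltP => [_|h1].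
  by rewrite -EFinD addrAC subrr add0r.
by congr EFin; apply/eqP; rewrite eq_le h0 h1.
Qed.

End box_measure.

Section box_mass.
Local Open Scope ereal_scope.
Context {R : realType} {n : nat} (w : spacetime R n -> R).
Hypothesis w_weight : is_weight w.
Implicit Types (x e : 'rV[R]_n) (t h : R) (A B : set (spacetime R n)).

Local Notation mu := (lebesgue_st R n).

Lemma weight_measurable_EFin (A : set (lebesgue_type R n)) : measurable A ->
  measurable_fun A (EFin \o w).
Proof.
move=> mA; apply/measurable_EFinP.
by apply: measurable_funS (weight_measurable w_weight).
Qed.

Lemma wint_ge0 A : 0 <= wint w A.
Proof. by apply: integral_ge0 => z _; rewrite lee_fin (weight_ge0 w_weight). Qed.

Lemma wint_subset A B : lebesgue_measurable R n A -> lebesgue_measurable R n B ->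
  A `<=` B -> wint w A <= wint w B.
Proof.
move=> mA mB AB; apply: (ge0_subset_integral mu mA mB (weight_measurable_EFin B mB) _ AB).
by move=> z _; rewrite lee_fin (weight_ge0 w_weight).
Qed.

Lemma wint_setU A B : lebesgue_measurable R n A -> lebesgue_measurable R n B ->
  wint w (A `|` B) <= wint w A + wint w B.
Proof.
move=> mA mB.
have mBA : lebesgue_measurable R n (B `\` A) by exact: measurableD.
have -> : A `|` B = A `|` (B `\` A) by rewrite setUDr setDv setD0.
have w0 z : (A `|` (B `\` A)) z -> 0 <= (w z)%:E.
  by rewrite lee_fin (weight_ge0 w_weight).
rewrite /wint (ge0_integral_setU mu mA mBA (weight_measurable_EFin _ (measurableU _ _ mA mBA)) w0).
  by apply: leeD2l; apply: (wint_subset _ _ mBA mB) => z [].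
by apply/disj_setPS => z [Az [_ /(_ Az)]].
Qed.

Lemma wint_bigsetU (I : Type) (r : seq I) (F : I -> set (spacetime R n)) :
  (forall i, lebesgue_measurable R n (F i)) ->
  wint w (\big[setU/set0]_(i <- r) F i) <= \sum_(i <- r) wint w (F i).
Proof.
move=> mF; elim: r => [|a r IH]; first by rewrite !big_nil /wint integral_set0.
rewrite !big_cons; apply: le_trans (wint_setU _ _ _ _) _ => //.
  by apply: bigsetU_measurable => i _; exact: mF.
exact: leeD2l.
Qed.

Lemma wint_box_fin x e t h : wint w (box x e t h) < +oo.
Proof.
pose K : set (spacetime R n) :=
  [set y : 'rV[R]_n | forall j, `[x ord0 j, (x ord0 j + e ord0 j)%R]%classic (y ord0 j)]
  `*` `[t, (t + h)%R]%classic.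
have cK : compact K.
  apply: compact_setX; last exact: segment_compact.
  apply: (@rV_compact _ n
    (fun j => `[x ord0 j, (x ord0 j + e ord0 j)%R]%classic)) => j.
  exact: segment_compact.
have mK : lebesgue_measurable R n K.
  apply: caratheodory_measurable_mu_ext; apply: measurableX.
    exact: (@measurable_rV_itvs R n (fun j => `[x ord0 j, (x ord0 j + e ord0 j)%R])).
  exact: measurable_itv.
apply: le_lt_trans (weight_locally_integrable w_weight cK).
apply: wint_subset => //; first exact: measurable_box.
move=> z [/= h1 h2]; split => /=.
  by move=> j; have /andP[a b] := h1 j; rewrite in_itv /= a ltW.
by move: h2; rewrite !in_itv /= => /andP[-> /ltW ->].
Qed.

End box_mass.

(** * Mass of small subsets *)

(** Bound for the mass of a subset of density [delta], in units of the [q]-mean times the volume.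
    For finite [q] the weight is split at [Lam] times the mean: the low part gives [Lam * delta],
    the high part the power of [Lam]. For [q = +oo] the density alone suffices. *)
Definition rh_factor {R : realType} (q : \bar R) (Lam delta : R) : R :=
  if q is r%:E then Lam * delta + Lam `^ (1 - r) else delta.

Section reverse_holder_subsets.
Local Open Scope ereal_scope.
Context {R : realType} {n : nat} (w : spacetime R n -> R).
Hypothesis w_weight : is_weight w.
Implicit Types (A E : set (spacetime R n)).

Local Notation mu := (lebesgue_st R n).

Let mwr (A : set (lebesgue_type R n)) (r : R) : measurable A ->
  measurable_fun A (fun z => (w z `^ r)%R%:E).
Proof.
move=> mA; apply/measurable_EFinP.
apply: (measurableT_comp (measurable_powR r)).
by apply: measurable_funS (weight_measurable w_weight).
Qed.

Lemma wint_le_ess_sup_on A E (k : R) : (0 <= k)%R ->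
  lebesgue_measurable R n E -> E `<=` A ->
  ess_sup_on w A < k%:E -> wint w E <= k%:E * mu E.
Proof.
move=> k0 mE EA /ereal_inf_lt[y /= wy yk].
rewrite -(integral_cst mu mE) /wint; apply: (ae_ge0_le_integral (mu := mu) mE).
- by move=> z _; rewrite lee_fin (weight_ge0 w_weight).
- exact: weight_measurable_EFin.
- by move=> z _; rewrite lee_fin.
- exact: measurable_cst.
move: wy => [N [mN N0 wN]]; exists N; split => // z nz.
apply: wN => wzy; apply: nz.
move: wzy => /= wzy /EA /wzy /le_trans; apply; exact: ltW.
Qed.

(* Splitting [w] at the height [lam] gives [w <= lam + lam^(1-r) w^r]; this
   replaces Hoelder's inequality. *)
Lemma wint_le_powR E (lam r : R) : (0 < lam)%R -> (1 < r)%R ->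
  lebesgue_measurable R n E ->
  wint w E <= lam%:E * mu E +
    (lam `^ (1 - r))%R%:E * wint (fun z => w z `^ r)%R E.
Proof.
move=> lam0 r1 mE.
have mlam : measurable_fun (E : set (lebesgue_type R n)) (cst lam%:E).
  exact: measurable_cst.
have mwlam : measurable_fun (E : set (lebesgue_type R n))
    (fun z => (lam `^ (1 - r))%R%:E * (w z `^ r)%R%:E).
  by apply: measurable_funeM; exact: mwr.
have wr0 z : E z -> 0 <= (w z `^ r)%R%:E by rewrite lee_fin powR_ge0.
have wlam0 z : E z -> 0 <= (lam `^ (1 - r))%R%:E * (w z `^ r)%R%:E.
  by move=> Ez; rewrite mule_ge0 ?wr0// lee_fin powR_ge0.
have lam_ge0 z : E z -> 0 <= cst lam%:E z by rewrite lee_fin ltW.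
rewrite -(integral_cst mu mE) /wint.
rewrite -(ge0_integralZl_EFin mu mE wr0 (mwr E r mE) (powR_ge0 _ _)).
rewrite -(ge0_integralD mu mE lam_ge0 mlam wlam0 mwlam).
apply: (ge0_le_integral mu mE).
- by move=> z _; rewrite lee_fin (weight_ge0 w_weight).
- exact: weight_measurable_EFin.
- exact: (emeasurable_funD mlam mwlam).
move=> z _; rewrite /= lee_fin.
have wz0 := weight_ge0 w_weight z.
have [wl|lw] := leP (w z) lam.
  by rewrite (le_trans wl)// lerDl mulr_ge0// powR_ge0.
rewrite -[leLHS]add0r; apply: lerD; first exact: ltW.
have wz1 : (0 < w z)%R by exact: lt_trans lw.
rewrite -[leLHS](powRr1 wz0) -{1}(subrK r 1%R) powRD; last first.
  by rewrite (gt_eqF wz1) implybT.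
apply: ler_wpM2r; first exact: powR_ge0.
have -> : (1 - r)%R = (- (r - 1))%R by rewrite opprB.
rewrite !powRN lef_pV2 ?posrE ?powR_gt0//.
by apply: ge0_ler_powR; rewrite ?nnegrE ?subr_ge0 ?ltW.
Qed.

(** For finite [q], [wint_le_powR] is applied at height [Lam * kap], which must be positive. The
    strict bound on the [q]-mean serves [q = +oo]: being an infimum, [ess_sup_on] then has an
    admissible bound below [kap]. *)
Lemma wint_le_q_mean (q : \bar R) A E (kap Lam delta V : R) :
  1 < q -> (0 < kap)%R -> (0 < Lam)%R -> (0 < V)%R ->
  lebesgue_measurable R n A -> lebesgue_measurable R n E -> E `<=` A ->
  mu A = V%:E -> mu E <= (delta * V)%:E -> q_mean q w A < kap%:E ->
  wint w E <= (kap * rh_factor q Lam delta * V)%:E.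
Proof.
move=> q1 kap0 Lam0 V0 mA mE EA muA muE; case: q q1 => [r| |]//=; last first.
  move=> _ /(wint_le_ess_sup_on A E kap (ltW kap0) mE EA) /le_trans; apply.
  by rewrite -mulrA EFinM lee_wpmul2l// lee_fin ltW.
rewrite lte_fin => r1 /ltW.
have r0 : (0 < r)%R by exact: lt_trans r1.
set X := mean _ _ => Xkap.
have I0 B : 0 <= wint (fun z => w z `^ r)%R B.
  by apply: integral_ge0 => z _; rewrite lee_fin powR_ge0.
have X0 : 0 <= X by rewrite mule_ge0// inve_ge0.
have {}Xkap : X <= (kap `^ r)%:E.
  rewrite -[leLHS](poweRe1 X0) -(mulVf (lt0r_neq0 r0)) poweRrM -poweR_EFin.
  apply: (gt0_ler_poweR (ltW r0)) => //; rewrite in_itv/= leey andbT.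
    exact: poweR_ge0.
  by rewrite lee_fin ltW.
have IA : wint (fun z => w z `^ r)%R A <= (V * kap `^ r)%:E.
  move: Xkap; rewrite /X /mean muA inver (gt_eqF V0).
  by rewrite lee_pdivrMl// -EFinM.
have IE : wint (fun z => w z `^ r)%R E <= (V * kap `^ r)%:E.
  apply: le_trans IA; apply: (ge0_subset_integral mu mE mA (mwr A r mA)) => //.
  by move=> z _; rewrite lee_fin powR_ge0.
apply: le_trans (wint_le_powR E (Lam * kap)%R r (mulr_gt0 Lam0 kap0) r1 mE) _.
rewrite (_ : (kap * _ * V)%R = (Lam * kap) * (delta * V) +
    (Lam * kap) `^ (1 - r) * (V * kap `^ r))%R; last first.
  have kapr : (kap `^ (1 - r) * kap `^ r = kap)%R.
    by rewrite -powRD ?subrK ?powRr1 ?(gt_eqF kap0) ?implybT// ltW.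
  rewrite (powRM _ (ltW Lam0) (ltW kap0)) /rh_factor.
  transitivity (kap * (Lam * delta) * V +
    Lam `^ (1 - r) * (kap `^ (1 - r) * kap `^ r) * V)%R; last by ring.
  by rewrite kapr; ring.
rewrite EFinD !EFinM -!EFinM; apply: leeD.
  by rewrite [leRHS]EFinM lee_wpmul2l// lee_fin mulr_ge0// ltW.
by rewrite [leRHS]EFinM lee_wpmul2l// lee_fin powR_ge0.
Qed.

End reverse_holder_subsets.

(** * Parabolic rectangles as boxes *)

Lemma rh_factor_constants {R : realType} (q : \bar R) (k : R) :
  (1 < q)%E -> 1 <= k ->
  exists (A : nat) (Lam k1 : R), [/\ (0 < A)%N, 0 < Lam, 1 <= k1,
    k * rh_factor q 1 1 <= k1 & k * rh_factor q Lam A%:R^-1 <= 4^-1].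
Proof.
move=> q1 k1; have k0 : 0 < k by exact: lt_le_trans k1.
case: q q1 => [r| |]//=; last first.
  move=> _; exists (Num.bound (4 * k)), 1, k.
  have hA : 4 * k < (Num.bound (4 * k))%:R by apply: archi_boundP; lra.
  have A0 : 0 < (Num.bound (4 * k))%:R :> R by lra.
  split => //; rewrite -?(ltr0n R)//; first by rewrite mulr1.
  by rewrite ler_pdivrMr//; lra.
rewrite lte_fin => r1.
(* [Lam] makes the high part [k * Lam^(1-r)] equal to 1/8; [A] is then chosen to bring the low part
   [k * Lam / A] below 1/8. *)
pose Lam := (8 * k) `^ (r - 1)^-1.
have Lam0 : 0 < Lam by rewrite powR_gt0//; lra.
pose A := Num.bound (8 * k * Lam).
have hA : 8 * k * Lam < A%:R.
  by apply: archi_boundP; rewrite !mulr_ge0// ltW.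
have A0 : 0 < A%:R :> R by apply: le_lt_trans hA; rewrite !mulr_ge0// ltW.
exists A, Lam, (2 * k); split => //.
- lra.
- by rewrite mulr1 powR1; lra.
have -> : Lam `^ (1 - r) = (8 * k)^-1.
  rewrite /Lam -powRrM (_ : (r - 1)^-1 * (1 - r) = -1); last by field; lra.
  by rewrite powR_inv1//; lra.
have kLam : Lam * A%:R^-1 <= (8 * k)^-1.
  rewrite ler_pdivrMr// -ler_pdivrMl ?invr_gt0; last by lra.
  by rewrite invrK ltW.
have -> : 4^-1 = k * ((8 * k)^-1 + (8 * k)^-1) by field; lra.
by rewrite ler_pM2l// lerD2r.
Qed.

Section parabolic_boxes.
Context {R : realType} {n : nat} (p : R).

Lemma lower_box (gamma : R) (P : parabolic_rectangle R n) :
  lower p gamma P = box (pcenter P - const_mx (pedge P / 2))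
    (const_mx (pedge P)) (ptime P - pedge P `^ p)
    ((1 - gamma) * pedge P `^ p).
Proof.
rewrite /lower /box /cube; congr (_ `*` _).
  apply/seteqP; split => y /= H j; have := H j; rewrite !mxE.
    by rewrite (_ : _ - _ / 2 + _ = pcenter P ord0 j + pedge P / 2)//; field.
  by rewrite (_ : _ - _ / 2 + _ = pcenter P ord0 j + pedge P / 2)//; field.
by rewrite (_ : _ - _ + _ = ptime P - gamma * pedge P `^ p)//; ring.
Qed.

Lemma upper_box (P : parabolic_rectangle R n) :
  upper p 0 P = box (pcenter P - const_mx (pedge P / 2))
    (const_mx (pedge P)) (ptime P) (pedge P `^ p).
Proof.
rewrite /upper /box /cube; congr (_ `*` _).
  apply/seteqP; split => y /= H j; have := H j; rewrite !mxE.
    by rewrite (_ : _ - _ / 2 + _ = pcenter P ord0 j + pedge P / 2)//; field.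
  by rewrite (_ : _ - _ / 2 + _ = pcenter P ord0 j + pedge P / 2)//; field.
by rewrite mul0r addr0.
Qed.

Lemma translate_box (x e : 'rV[R]_n) (t h : R) (v : spacetime R n) :
  translate (box x e t h) v = box (x + v.1) e (t + v.2) h.
Proof.
apply/seteqP; split => [_ [z [/= zx zt] <-]|z [/= zx zt]].
  split => /= [j|].
    have := zx j; rewrite !mxE => /andP[? ?]; apply/andP; split; lra.
  move: zt; rewrite !in_itv/= => /andP[? ?]; apply/andP; split; lra.
exists (z - v); last by rewrite subrK.
split => /= [j|].
  have := zx j; rewrite !mxE => /andP[? ?]; apply/andP; split; lra.
move: zt; rewrite !in_itv/= => /andP[? ?]; apply/andP; split; lra.
Qed.

Local Open Scope ereal_scope.
Variables (q : \bar R) (w : spacetime R n -> R) (k : R).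
Hypotheses (w_weight : is_weight w) (k0 : (0 <= k)%R) (q1 : 1 < q).
Hypothesis wk : RHplus_const p q w <= k%:E.

Local Notation mu := (lebesgue_st R n).

Lemma q_mean_le_mean (P : parabolic_rectangle R n) :
  mean w (upper p 0 P) < +oo ->
  q_mean q w (lower p 0 P) <= k%:E * mean w (upper p 0 P).
Proof.
have : q_mean q w (lower p 0 P) * (mean w (upper p 0 P))^-1 <= k%:E.
  by apply: le_trans wk; apply: ereal_sup_ubound; exists P.
have : 0 <= mean w (upper p 0 P) by rewrite mule_ge0 ?wint_ge0// inve_ge0.
case: (mean w (upper p 0 P)) => [a| |]//; rewrite lee_fin => a0 + _.
(* The inverse of a zero mean is [+oo], so a finite quotient forces the [q]-mean to vanish as
   well. *)
have [->|an0] := eqVneq a 0%R.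
  rewrite inve0 mule0; apply: contraTT; rewrite -!ltNge => qm.
  by rewrite gt0_muley// ltey.
have {an0}a0 : (0 < a)%R by rewrite lt_neqAle eq_sym an0.
by rewrite inver gt_eqF// lee_pdivrMr.
Qed.

(** The two boxes are the lower and upper halves of one parabolic rectangle, centered in time at
    their common face, so the reverse Hoelder inequality compares them directly. *)
Lemma wint_le_next (x : 'rV[R]_n) (l t Lam delta : R) (E : set (spacetime R n)) :
  (0 < l)%R -> (0 < Lam)%R -> lebesgue_measurable R n E ->
  E `<=` box x (const_mx l) t (l `^ p)%R ->
  mu E <= (delta * (l ^+ n * l `^ p))%:E ->
  wint w E <= (k * rh_factor q Lam delta)%:E *
    wint w (box x (const_mx l) (t + l `^ p)%R (l `^ p)%R).
Proof.
move=> l0 Lam0 mE EA muE.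
pose P := ParabolicRectangle (x + const_mx (l / 2))%R (t + l `^ p)%R l0.
have lowerP : lower p 0 P = box x (const_mx l) t (l `^ p)%R.
  by rewrite lower_box /= addrK subr0 mul1r addrK.
have upperP : upper p 0 P = box x (const_mx l) (t + l `^ p)%R (l `^ p)%R.
  by rewrite upper_box /= addrK.
have lp0 : (0 < l `^ p)%R by exact: powR_gt0.
have V0 : (0 < l ^+ n * l `^ p)%R by rewrite mulr_gt0// exprn_gt0.
have mubox s : mu (box x (const_mx l) s (l `^ p)%R) = (l ^+ n * l `^ p)%:E.
  rewrite lebesgue_st_box ?ltW//; last by move=> j; rewrite mxE ltW.
  by under eq_bigr do rewrite mxE; rewrite prodr_const card_ord.
have := wint_ge0 w w_weight (upper p 0 P).
have : wint w (upper p 0 P) < +oo by rewrite upperP wint_box_fin.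
have meanP : mean w (upper p 0 P) =
    ((l ^+ n * l `^ p)^-1)%:E * wint w (upper p 0 P).
  by rewrite /mean {1}upperP mubox inver gt_eqF.
have := q_mean_le_mean P; rewrite meanP -upperP {meanP}.
case: (wint w (upper p 0 P)) => [a| |]//; rewrite -!EFinM ltry lowerP lee_fin.
move=> /(_ isT) qm _ a0; apply/lee_addgt0Pr => e e0; rewrite -EFinD.
set V := (l ^+ n * l `^ p)%R in V0 mubox muE qm *.
pose c := rh_factor q Lam delta.
(* Slack that makes the bound on the [q]-mean strict and positive even when [k * a] is zero; it
   costs at most [e] in the final estimate. *)
pose d := (e / (`|c| * V + 1))%R.
have cV0 : (0 <= `|c| * V)%R by rewrite mulr_ge0// ltW.
have d0 : (0 < d)%R by rewrite divr_gt0// ltr_pwDr.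
have kap0 : (0 < k * (V^-1 * a) + d)%R.
  by rewrite ltr_wpDl// !mulr_ge0// invr_ge0 ltW.
have := wint_le_q_mean w w_weight q _ _ _ Lam delta _ q1 kap0 Lam0 V0
  (measurable_box x (const_mx l) t _) mE EA (mubox t) muE.
rewrite (le_lt_trans qm) => [/(_ isT)/le_trans|]; last by rewrite lte_fin ltrDl.
apply; rewrite lee_fin -/c.
have -> : ((k * (V^-1 * a) + d) * c * V = k * c * a + d * (c * V))%R.
  by field; exact: lt0r_neq0.
rewrite lerD2l (@le_trans _ _ (d * (`|c| * V)))%R//.
  by rewrite ler_pM2l// ler_pM2r// ler_norm.
by rewrite /d mulrAC ler_pdivrMr ?ltr_pwDr// ler_pM2l// lerDl.
Qed.

End parabolic_boxes.

(** * The mass of boxes *)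

Lemma sum_le_card_max {R : realFieldType} (I : finType) (f : I -> R) (m : R) :
  (0 < #|I|)%N -> m <= \sum_i f i -> exists i, m <= #|I|%:R * f i.
Proof.
move=> I0 mf; apply: contrapT => /forallNP fm.
have /card_gt0P[i0 _] := I0.
suff : #|I|%:R * \sum_i f i < #|I|%:R * m.
  by rewrite ltr_pM2l ?ltr0n// ltNge mf.
have -> : #|I|%:R * m = \sum_(i : I) m by rewrite sumr_const mulr_natl.
rewrite mulr_sumr.
by apply: ltr_sum => [|i _]; [apply/hasP; exists i0; rewrite ?mem_index_enum|
  rewrite ltNge; exact/negP/fm].
Qed.

(** The intervals form a grid of step [e']; the minimum pulls those that would stick out back
    inside, so that the cover stays within the original interval. *)
Lemma sub_itv_cover {R : archiRealFieldType} (a e e' y : R) (M : nat) :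
  0 < e' <= e -> e <= M%:R * e' -> a <= y < a + e ->
  exists k : 'I_M,
    Num.min (a + k%:R * e') (a + e - e') <= y <
    Num.min (a + k%:R * e') (a + e - e') + e'.
Proof.
move=> /andP[e'0 e'e] eM /andP[ay ye].
have d0 : 0 <= (y - a) / e' by rewrite divr_ge0 ?subr_ge0// ltW.
have /andP[] := truncn_itv d0; set k := Num.trunc _ => ky yk.
rewrite ler_pdivlMr// in ky; rewrite ltr_pdivrMr// -addn1 natrD in yk.
have kM : (k < M)%N.
  by rewrite -(ltr_nat R) -(ltr_pM2r e'0); lra.
exists (Ordinal kM) => /=; rewrite /Num.min; case: ifPn => [?|/negP/negP].
  by apply/andP; split; lra.
by rewrite -leNgt => ?; apply/andP; split; lra.
Qed.

Section mass.
Context {R : realType} {n : nat} (w : spacetime R n -> R).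
Hypothesis w_weight : is_weight w.
Implicit Types (x e : 'rV[R]_n) (t h : R).

Definition mass x e t h : R := fine (wint w (box x e t h)).

Lemma wint_box x e t h : wint w (box x e t h) = (mass x e t h)%:E.
Proof.
by rewrite /mass fineK// ge0_fin_numE ?wint_ge0// wint_box_fin.
Qed.

Lemma mass_ge0 x e t h : 0 <= mass x e t h.
Proof. by rewrite fine_ge0// wint_ge0. Qed.

Lemma mass_le x e t h x' e' t' h' :
  (forall j, x' ord0 j <= x ord0 j /\
    x ord0 j + e ord0 j <= x' ord0 j + e' ord0 j) ->
  t' <= t -> t + h <= t' + h' -> mass x e t h <= mass x' e' t' h'.
Proof.
move=> xx' t't th; rewrite -lee_fin -!wint_box.
apply: (wint_subset w w_weight); [exact: measurable_box|exact: measurable_box|].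
move=> z [/= zx zt]; split => /= [j|].
  have [? ?] := xx' j; have /andP[? ?] := zx j; apply/andP; split; lra.
by move: zt; rewrite !in_itv/= => /andP[? ?]; apply/andP; split; lra.
Qed.

Lemma mass_cover (I : finType) x e t h (X E : I -> 'rV[R]_n) (T H : I -> R) :
  box x e t h `<=` \bigcup_i box (X i) (E i) (T i) (H i) ->
  mass x e t h <= \sum_i mass (X i) (E i) (T i) (H i).
Proof.
move=> cover; rewrite -lee_fin -wint_box -sumEFin.
under eq_bigr do rewrite -wint_box.
apply: le_trans (wint_bigsetU w w_weight _ _ _ _) => [|i]; last first.
  exact: measurable_box.
apply: (wint_subset w w_weight); first exact: measurable_box.
  by apply: bigsetU_measurable => i _; exact: measurable_box.
apply: subset_trans cover _; rewrite -bigcup_seq => z [i _ zi].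
by exists i => //=; rewrite mem_index_enum.
Qed.

(** Pigeonhole: the box is covered by [M ^ n.+1] boxes of the smaller size, all contained in it, and
    the heaviest carries at least the average share. *)
Lemma mass_subbox x e t h e' h' (M : nat) :
  (forall j, 0 < e' ord0 j <= e ord0 j) ->
  (forall j, e ord0 j <= M%:R * e' ord0 j) ->
  0 < h' <= h -> h <= M%:R * h' ->
  exists x' t',
    [/\ forall j, x ord0 j <= x' ord0 j /\
          x' ord0 j + e' ord0 j <= x ord0 j + e ord0 j,
        t <= t', t' + h' <= t + h &
        mass x e t h <= M%:R ^+ n.+1 * mass x' e' t' h'].
Proof.
move=> e'e eM h'h hM; have /andP[h'0 hh'] := h'h.
have M0 : (0 < M)%N.
  by rewrite -(ltr_nat R) -(ltr_pM2r h'0) mul0r (lt_le_trans h'0)// (le_trans hh').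
pose c a b b' (k : nat) : R := Num.min (a + k%:R * b') (a + b - b').
have c_sub a b b' k : 0 < b' <= b -> a <= c a b b' k /\ c a b b' k + b' <= a + b.
  move=> /andP[b'0 b'b]; have kb : 0 <= k%:R * b' :> R by rewrite mulr_ge0// ltW.
  rewrite /c /Num.min; case: ifPn => [?|/negP/negP]; first by split; lra.
  by rewrite -leNgt => ?; split; lra.
pose I : finType := ({ffun 'I_n -> 'I_M} * 'I_M)%type.
pose X (f : I) : 'rV[R]_n := \row_j c (x ord0 j) (e ord0 j) (e' ord0 j) (f.1 j).
pose T (f : I) : R := c t h h' f.2.
have cI : #|I| = (M ^ n.+1)%N by rewrite card_prod card_ffun !card_ord expnSr.
have [] := @sum_le_card_max R I (fun f => mass (X f) e' (T f) h') (mass x e t h).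
- by rewrite cI expn_gt0 M0.
- apply: mass_cover => z [/= zx zt].
  have /choice[f fP] : forall j, exists k : 'I_M,
      c (x ord0 j) (e ord0 j) (e' ord0 j) k <= z.1 ord0 j <
      c (x ord0 j) (e ord0 j) (e' ord0 j) k + e' ord0 j.
    by move=> j; exact: sub_itv_cover.
  have [k kP] : exists k : 'I_M, c t h h' k <= z.2 < c t h h' k + h'.
    by apply: sub_itv_cover => //; move: zt; rewrite in_itv.
  exists ([ffun j => f j], k) => //; split => /= [j|]; last by rewrite in_itv.
  by rewrite mxE ffunE.
move=> f; rewrite cI natrX => mf; exists (X f), (T f); split => //.
- by move=> j; rewrite mxE; exact: c_sub.
- by have [] := c_sub t h h' f.2 h'h.
- by have [] := c_sub t h h' f.2 h'h.
Qed.

End mass.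

(** * One time step of a slab *)

Section walk_step.
Context {R : realType} {n : nat} (w : spacetime R n -> R) (p : R).
Hypothesis w_weight : is_weight w.
Variables (A : nat) (i : 'I_n) (sigma : R).
Hypotheses (A0 : (0 < A)%N) (sigma1 : sigma = -1 \/ sigma = 1).
Implicit Types (x e : 'rV[R]_n) (t h l : R).

Local Notation mass := (mass w).

Definition slab l : 'rV[R]_n := \row_j (if j == i then l / A%:R else l).

Lemma lebesgue_slab l x t h : 0 <= l -> 0 <= h ->
  lebesgue_st R n (box x (slab l) t h) = (A%:R^-1 * (l ^+ n * h))%:E.
Proof.
move=> l0 h0; rewrite lebesgue_st_box//; last first.
  by move=> j; rewrite mxE; case: ifP => // _; rewrite divr_ge0.
congr EFin; rewrite mulrA; congr (_ * _).
transitivity (\prod_j ((if j == i then A%:R^-1 else 1) * l)).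
  by apply: eq_bigr => j _; rewrite mxE; case: ifP => _; rewrite ?mul1r// mulrC.
by rewrite big_split/= -big_mkcond/= big_pred1_eq prodr_const card_ord.
Qed.

Hypothesis slab_gain : forall (l : R) (c x : 'rV[R]_n) t, 0 < l ->
  (forall j, c ord0 j <= x ord0 j /\
    x ord0 j + slab l ord0 j <= c ord0 j + l) ->
  4 * mass x (slab l) t (l `^ p) <= mass c (const_mx l) (t + l `^ p) (l `^ p).

(* The weights [2^j] let staying put ([j = 0]) gain a factor 2, at the price of
   losing an exponential in the distance travelled. *)
Lemma slab_step l x t : 0 < l ->
  exists j : nat, (j < A)%N /\
    2 * mass x (slab l) t (l `^ p) <=
    2 ^+ j * mass (x + (sigma * (j%:R * (l / A%:R))) *: delta_mx ord0 i)
      (slab l) (t + l `^ p) (l `^ p).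
Proof.
move=> l0; set s := l / A%:R; set h := l `^ p; set m := mass x _ _ _.
have A0' : 0 < A%:R :> R by rewrite ltr0n.
have s0 : 0 < s by rewrite divr_gt0.
have lE : l = A%:R * s by rewrite /s; field; exact: lt0r_neq0.
have sl : s <= l by rewrite lE ler_peMl ?ler1n// ltW.
pose x' j := x + (sigma * (j%:R * s)) *: delta_mx ord0 i.
(* The cube is placed so that the slab lies at its trailing face: [c = x] when [sigma = 1], and
   shifted back by [l - s] when [sigma = -1]. *)
pose c : 'rV[R]_n := x + ((sigma - 1) / 2 * (l - s)) *: delta_mx ord0 i.
have hx' k j : x' k ord0 j = x ord0 j + (if j == i then sigma * (k%:R * s) else 0).
  by rewrite !mxE eqxx/=; case: eqP; rewrite ?mulr1 ?mulr0.
have hc j : c ord0 j = x ord0 j + (if j == i then (sigma - 1) / 2 * (l - s) else 0).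
  by rewrite !mxE eqxx/=; case: eqP; rewrite ?mulr1 ?mulr0.
have gain : 4 * m <= mass c (const_mx l) (t + h) h.
  apply: slab_gain => // j; rewrite hc mxE -/s; case: eqP => _; last by split; lra.
  by case: sigma1 => ->; split; lra.
have cover : mass c (const_mx l) (t + h) h <=
    \sum_(j < A) mass (x' j) (slab l) (t + h) h.
  apply: (mass_cover w w_weight) => z [/= zc zt].
  have [k /andP[ky yk]] : exists k : 'I_A, c ord0 i + k%:R * s <= z.1 ord0 i <
      c ord0 i + k%:R * s + s.
    have [||//|k] := @sub_itv_cover R (c ord0 i) l s (z.1 ord0 i) A.
    - by rewrite s0.
    - by rewrite -lE.
    - by have := zc i; rewrite [const_mx _ _ _]mxE.
    move=> kP; exists k.
    have kA : k%:R + 1 <= A%:R :> R by rewrite natr1 ler_nat.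
    have kl : k%:R * s + s <= l by rewrite lE -[X in _ + X]mul1r -mulrDl ler_pM2r.
    by move: kP; rewrite min_l//; lra.
  (* Positions are counted from the trailing face, hence in reverse order when [sigma = -1]. *)
  pose k' := if sigma == 1 then k else rev_ord k.
  have hk' : sigma * (k'%:R * s) = (sigma - 1) / 2 * (l - s) + k%:R * s.
    rewrite /k'; case: sigma1 => ->; last by rewrite eqxx; lra.
    rewrite eqr_oppLR (_ : (1 == - 1 :> R) = false)/=; last first.
      by apply/negbTE; rewrite gt_eqF//; lra.
    by rewrite natrB// -natr1 lE; lra.
  exists k' => //; split => //= j.
  have := zc j; rewrite hx' hc !mxE -/s; have [->|_ //] := eqVneq j i.
  by rewrite hk' => _; move: ky yk; rewrite hc eqxx => ky yk; lra.
(* If every [j] failed, the [A] slabs would have masses below [2 * m / 2^j], with sum less than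
   [4 * m], against [gain]. *)
apply: contrapT => /forallNP no.
have m0 : 0 <= m by exact: mass_ge0.
have {}no (j : 'I_A) : 2 ^+ j * mass (x' j) (slab l) (t + h) h < 2 * m.
  by rewrite ltNge; apply/negP => jm; apply: (no j).
have sum2 k : \sum_(j < k) (2 * m) * 2^-1 ^+ j = 4 * m * (1 - 2^-1 ^+ k).
  elim: k => [|k IH]; first by rewrite big_ord0 expr0 subrr mulr0.
  by rewrite big_ord_recr/= IH exprSr; lra.
suff : mass c (const_mx l) (t + h) h < 4 * m by rewrite ltNge gain.
apply: (le_lt_trans cover).
apply: (@lt_le_trans _ _ (\sum_(j < A) (2 * m) * 2^-1 ^+ j)).
  apply: ltr_sum => [|j _].
    by apply/hasP; exists (Ordinal A0) => //; rewrite mem_index_enum.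
  by rewrite exprVn ltr_pdivlMr ?exprn_gt0// mulrC.
by rewrite sum2 ler_piMr ?mulr_ge0// gerBl exprn_ge0.
Qed.

End walk_step.

(** * The walk through dyadic scales *)

Section dyadic_scales.
Context {R : realType} (p : R).
Hypothesis p1 : 1 < p.

(** Ratio of the time lengths of boxes at consecutive dyadic scales. *)
Definition half_powR : R := 2^-1 `^ p.

Lemma half_powR_gt0 : 0 < half_powR.
Proof. by rewrite powR_gt0// invr_gt0. Qed.

(** Here [1 < p] enters: doubling the number of steps at each halving of the edge still makes the
    times spent at the scales a convergent geometric series. *)
Lemma half_powR_lt : half_powR < 2^-1.
Proof.
have h2 : 0 < 2^-1 :> R by rewrite invr_gt0.
rewrite /half_powR -[p](subrKC 1) powRD; last by rewrite (gt_eqF h2) implybT.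
rewrite powRr1 ?ltW// gtr_pMr//.
have := @gt0_ltr_powR R (p - 1) _ 2^-1 1; rewrite powR1; apply.
- by rewrite subr_gt0.
- by rewrite nnegrE ltW.
- by rewrite nnegrE.
- by rewrite invf_lt1 ?ltr1n.
Qed.

Lemma half_powR_sqr_le : half_powR ^+ 2 <= 4^-1.
Proof.
have h0 := ltW half_powR_gt0; have h2 := ltW half_powR_lt.
by have := ler_pM h0 h0 h2 h2; rewrite expr2; lra.
Qed.

Lemma powR_half (L : R) m : 0 <= L ->
  (L / 2 ^+ m) `^ p = L `^ p * half_powR ^+ m.
Proof.
move=> L0; have h20 : 0 <= 2^-1 :> R by rewrite invr_ge0.
rewrite -exprVn powRM ?exprn_ge0//; congr (_ * _).
transitivity ((2^-1 `^ m%:R) `^ p); first by rewrite powR_mulrn.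
rewrite -powRrM mulrC powRrM; exact: (powR_mulrn m (powR_ge0 _ _)).
Qed.

End dyadic_scales.

Section walk.
Context {R : realType} {n : nat} (w : spacetime R n -> R) (p : R).
Hypotheses (w_weight : is_weight w) (p1 : 1 < p).
Variables (A : nat) (i : 'I_n) (sigma : R).
Hypotheses (A0 : (0 < A)%N) (sigma1 : sigma = -1 \/ sigma = 1).
Implicit Types (x y : 'rV[R]_n) (t : R).

Local Notation mass := (mass w).
Local Notation slab := (slab A i).
Local Notation kap := (half_powR p).

Hypothesis slab_gain : forall (l : R) (c x : 'rV[R]_n) t, 0 < l ->
  (forall j, c ord0 j <= x ord0 j /\
    x ord0 j + slab l ord0 j <= c ord0 j + l) ->
  4 * mass x (slab l) t (l `^ p) <= mass c (const_mx l) (t + l `^ p) (l `^ p).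

Variables (X : 'rV[R]_n) (L t0 : R).
Hypothesis L0 : 0 < L.

Let lev m : R := L / 2 ^+ m.
Let s m : R := lev m / A%:R.
Let h m : R := lev m `^ p.

Let A0' : 0 < A%:R :> R. Proof. by rewrite ltr0n. Qed.
Let lev0 m : 0 < lev m. Proof. by rewrite divr_gt0// exprn_gt0. Qed.
Let s0 m : 0 < s m. Proof. by rewrite divr_gt0. Qed.
Let h0 m : 0 < h m. Proof. by rewrite powR_gt0. Qed.

Let lev_s m : lev m = A%:R * s m.
Proof. by rewrite /s; field; exact: lt0r_neq0. Qed.

Let levL m : lev m <= L.
Proof. by rewrite ler_pdivrMr ?exprn_gt0// ler_peMr ?exprn_ege1 ?ler1n// ltW. Qed.

Let levS m : lev m = 2 * lev m.+1.
Proof. by rewrite /lev exprS; field; rewrite expf_neq0. Qed.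

Let sS m : s m = 2 * s m.+1.
Proof. by rewrite /s levS mulrA. Qed.

Let hE m : h m = L `^ p * kap ^+ m.
Proof. by rewrite /h powR_half// ltW. Qed.

(* Distance from the trailing face of the cube with corner [X] and edge [L] to
   the trailing face of the slab, in the direction of motion. *)
Definition progress m x : R :=
  sigma * (x ord0 i - X ord0 i) + (1 - sigma) / 2 * (L - s m).

(** The overshoot [L / 8] is what one step from progress below [L / 8] can reach, as it moves the
    leading face to at most one cube edge further. A slab in the tube with progress at least [L / 8]
    thus lies in the cube shifted by exactly [L / 8]. *)
Definition in_tube m x : Prop :=
  [/\ forall j, j != i -> X ord0 j <= x ord0 j /\ x ord0 j + lev m <= X ord0 j + L,
      0 <= progress m x & progress m x + s m <= L + L / 8].

Definition move (d : R) x : 'rV[R]_n := x + (sigma * d) *: delta_mx ord0 i.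

Let moveE d x j :
  move d x ord0 j = x ord0 j + (if j == i then sigma * d else 0).
Proof. by rewrite !mxE eqxx/=; case: eqP; rewrite ?mulr1 ?mulr0. Qed.

Let progress_move m d x : progress m (move d x) = progress m x + d.
Proof. by rewrite /progress moveE eqxx; case: sigma1 => ->; lra. Qed.

Let in_tube_move m x (j : nat) : in_tube m x -> progress m x < L / 8 ->
  (j < A)%N -> in_tube m (move (j%:R * s m) x).
Proof.
move=> [xX px pL] px8 jA; have js : 0 <= j%:R * s m by rewrite mulr_ge0// ltW.
have jA' : j%:R * s m + s m <= lev m.
  by rewrite lev_s -[X in _ + X]mul1r -mulrDl ler_pM2r// natr1 ler_nat.
split; rewrite ?progress_move.
- by move=> l li; rewrite moveE (negbTE li) addr0; exact: xX.
- by lra.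
- by have := levL m; lra.
Qed.

Let step_bound m x (j : nat) : in_tube m x ->
  progress m (move (j%:R * s m) x) < L / 8 -> (j <= A * 2 ^ m)%N.
Proof.
move=> [_ px _]; rewrite progress_move => j8.
rewrite -(ler_nat R) -(ler_pM2r (s0 m)) natrM natrX mulrAC -lev_s.
rewrite divfK ?expf_neq0//.
by move: px j8 L0; lra.
Qed.

(** Iterates [slab_step] [K] times: each step gains a factor 2 and loses [2^j] for [j] positions.
    The hypothesis says that slabs past [L / 8] are too light to be reached, so the total
    displacement stays within [A * 2 ^ m] positions. *)
Lemma walk_within_level m x t (K : nat) : in_tube m x ->
  (forall x' t', in_tube m x' -> L / 8 <= progress m x' ->
    t <= t' <= t + K%:R * h m ->
    2 ^+ (A * 2 ^ m + A) * mass x' (slab (lev m)) t' (h m) <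
    mass x (slab (lev m)) t (h m)) ->
  exists x', [/\ in_tube m x', progress m x' < L / 8 &
    2 ^+ K * mass x (slab (lev m)) t (h m) <=
    2 ^+ (A * 2 ^ m) * mass x' (slab (lev m)) (t + K%:R * h m) (h m)].
Proof.
move=> xT; set W := mass x _ _ _ => no.
have W0 : 0 <= W by exact: mass_ge0.
(* The extra [A] in the budget pays for the latest step, made before the new position is known to be
   short of [L / 8]. *)
have stuck x' t' (a b : nat) : in_tube m x' -> t <= t' <= t + K%:R * h m ->
    (b <= A * 2 ^ m + A)%N ->
    2 ^+ a * W <= 2 ^+ b * mass x' (slab (lev m)) t' (h m) ->
    progress m x' < L / 8.
  move=> x'T tt' bA aW; rewrite ltNge; apply/negP => /(no _ _ x'T)/(_ tt').
  rewrite ltNge => /negP; apply.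
  apply: le_trans (le_trans aW _); first by rewrite ler_peMl// exprn_ege1// ler1n.
  by rewrite ler_wpM2r ?mass_ge0// ler_weXn2l// ler1n.
suff : forall k, (k <= K)%N -> exists j : nat,
    [/\ in_tube m (move (j%:R * s m) x),
      progress m (move (j%:R * s m) x) < L / 8 &
      2 ^+ k * W <=
      2 ^+ j * mass (move (j%:R * s m) x) (slab (lev m)) (t + k%:R * h m) (h m)].
  move=> /(_ K (leqnn K))[j [jT j8 jW]]; exists (move (j%:R * s m) x); split => //.
  apply: le_trans jW _; rewrite ler_wpM2r ?mass_ge0// ler_weXn2l ?ler1n//.
  exact: step_bound xT j8.
elim=> [_|k IH kK].
  exists 0%N; have -> : move (0%:R * s m) x = x.
    by rewrite /move mul0r mulr0 scale0r addr0.
  split => //; last by rewrite !expr0 mul0r addr0.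
  apply: (stuck _ t 0%N 0%N) => //.
  by rewrite lexx lerDl mulr_ge0// ltW.
have [j [jT j8 jW]] := IH (ltnW kK).
have [j' [j'A]] := slab_step w p w_weight A i sigma A0 sigma1 slab_gain (lev m)
  (move (j%:R * s m) x) (t + k%:R * h m) (lev0 m).
have -> : move (j%:R * s m) x + (sigma * (j'%:R * (lev m / A%:R))) *: delta_mx ord0 i
    = move ((j + j')%:R * s m) x.
  by rewrite /move -addrA -scalerDl -mulrDr -mulrDl natrD.
rewrite -/(h m) (_ : _ + _ + h m = t + k.+1%:R * h m); last first.
  by rewrite -natr1; ring.
move=> j'W; exists (j + j')%N.
have jj'T : in_tube m (move ((j + j')%:R * s m) x).
  have := in_tube_move _ _ _ jT j8 j'A.
  by rewrite {1}/move /move -addrA -scalerDl -mulrDr -mulrDl natrD.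
have jj'W : 2 ^+ k.+1 * W <= 2 ^+ (j + j') *
    mass (move ((j + j')%:R * s m) x) (slab (lev m)) (t + k.+1%:R * h m) (h m).
  rewrite exprS -mulrA (le_trans (ler_wpM2l _ jW))// mulrCA exprD -mulrA.
  by rewrite ler_wpM2l// exprn_ge0.
split => //; apply: (stuck _ _ _ _ jj'T _ _ jj'W).
  apply/andP; split; last by rewrite lerD2l ler_pM2r// ler_nat.
  by rewrite lerDl mulr_ge0// ltW.
by rewrite leq_add ?(ltnW j'A)//; exact: step_bound xT j8.
Qed.

(** [M] pieces per edge suffice, in space and in time, both for the first slab of edge [L / 4] and
    for each halving. [N] makes the doublings at one scale outweigh the displacement and the
    subdivision, with a factor [H] to spare. *)
Variables (M N : nat).
Hypotheses (MA : (4 * A <= M)%N) (Mkap : 1 <= M%:R * kap ^+ 2).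
Hypothesis NM : 2 ^+ A * M%:R ^+ n.+1 * 2 ^+ A.+1 <= 2 ^+ N :> R.

Let rho : R := 2 * kap.
(** Closed form of the sum of [N * 2 ^ j * h j] over [j >= m], the time needed from scale [m]
    onwards. *)
Let tau m : R := N%:R * L `^ p * rho ^+ m / (1 - rho).

Let kap0 : 0 < kap. Proof. exact: half_powR_gt0. Qed.
Let kap2 : kap < 2^-1. Proof. exact: half_powR_lt. Qed.
Let Lp0 : 0 < L `^ p. Proof. exact: powR_gt0. Qed.
Let rho0 : 0 < rho. Proof. by rewrite mulr_gt0. Qed.
Let rho1 : rho < 1. Proof. by rewrite /rho; move: kap2; lra. Qed.

Let tau_ge0 m : 0 <= tau m.
Proof.
rewrite divr_ge0 ?subr_ge0 ?(ltW rho1)//.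
by rewrite !mulr_ge0 ?exprn_ge0 ?(ltW rho0) ?(ltW Lp0).
Qed.

(* The [N 2^m] steps made at scale [m] take total time [N L^p rho^m], summable
   because [p > 1]. *)
Let tauS m : tau m = (N * 2 ^ m)%:R * h m + tau m.+1.
Proof.
rewrite /tau hE natrM natrX exprS exprMn.
by field; rewrite subr_eq0 eq_sym (lt_eqF rho1).
Qed.

Let Mn : R := M%:R ^+ n.+1.
Let H : R := 2 ^+ A.+1.

Let M0 : (0 < M)%N. Proof. by apply: leq_trans MA; rewrite muln_gt0. Qed.
Let Mn1 : 1 <= Mn. Proof. by rewrite exprn_ege1// ler1n. Qed.
Let H1 : 1 <= H. Proof. by rewrite exprn_ege1// ler1n. Qed.
Let Mn0 : 0 < Mn. Proof. exact: lt_le_trans Mn1. Qed.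
Let H0 k : 0 < H ^+ k. Proof. by rewrite exprn_gt0// (lt_le_trans _ H1). Qed.
Let MnH0 : 0 < Mn * H ^+ 4. Proof. exact: mulr_gt0. Qed.
Let Mkap1 : 1 <= M%:R * kap.
Proof.
apply: le_trans Mkap _; rewrite ler_wpM2l// expr2 ler_piMl ?(ltW kap0)//.
by move: kap2; lra.
Qed.

Variable T : R.
Hypothesis TL : L `^ p / 2 <= T <= L `^ p.

Let W := mass X (const_mx L) t0 T.
Let Tend := t0 + L `^ p + tau 2.

(** Invariant of the walk: a slab at scale [m] that still has time for all finer scales and has
    gained the factor [c]. The constant [Mn * H ^+ 4] is fixed so that [c = H ^+ (2 ^ m)] already
    holds at [m = 2]. *)
Let state m c := exists x t, [/\ in_tube m x, t0 <= t, t + h m + tau m <= Tend &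
  W * c <= Mn * H ^+ 4 * mass x (slab (lev m)) t (h m)].

Let in_tube_sub m x (y : 'rV[R]_n) : (forall j, x ord0 j <= y ord0 j /\
    y ord0 j + slab (lev m.+1) ord0 j <= x ord0 j + slab (lev m) ord0 j) ->
  in_tube m x -> in_tube m.+1 y.
Proof.
move=> xy [xX px pL].
have [xyi yxi] := xy i; rewrite !mxE eqxx -/(s m) -/(s m.+1) in yxi.
split.
- move=> j ji; have [? ?] := xX j ji; have [? yxj] := xy j.
  by rewrite !mxE (negbTE ji) in yxj; split; lra.
- move: (sS m) px; rewrite /progress; case: sigma1 => ->; lra.
- move: (sS m) pL; rewrite /progress; case: sigma1 => ->; lra.
Qed.

Let start_state : state 2 (H ^+ 4).
Proof.
have kk : kap ^+ 2 <= 4^-1 by exact: half_powR_sqr_le.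
have h2 : h 2 = kap ^+ 2 * L `^ p by rewrite hE mulrC.
have hT : 0 < h 2 <= T.
  rewrite h0/= h2; have /andP[+ _] := TL; apply: le_trans.
  by rewrite mulrC ler_pM2l//; lra.
have hM : T <= M%:R * h 2.
  have /andP[_ /le_trans] := TL; apply.
  by rewrite h2 mulrA ler_peMl// ltW.
have slab2 j : 0 < slab (lev 2) ord0 j <= (const_mx L : 'rV[R]_n) ord0 j.
  rewrite !mxE; case: eqP => _; rewrite ?lev0 ?levL// -/(s 2) s0/=.
  apply: le_trans (levL 2); by rewrite lev_s ler_peMl ?ler1n// ltW.
have slab2M j : (const_mx L : 'rV[R]_n) ord0 j <= M%:R * slab (lev 2) ord0 j.
  have L4 : L = (4 * A)%:R * s 2.
    by rewrite natrM -mulrA -lev_s /lev; field.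
  have LM : L <= M%:R * s 2 by rewrite {1}L4 ler_pM2r// ler_nat.
  rewrite !mxE; case: eqP => _ //; apply: le_trans LM _.
  by rewrite ler_wpM2l// lev_s ler_peMl ?ler1n// ltW.
have [x [t [xX t0t tT WM]]] :=
  mass_subbox w w_weight X (const_mx L) t0 T (slab (lev 2)) (h 2) M slab2 slab2M hT hM.
exists x, t; split => //.
- have [xi1 xi2] := xX i; rewrite !mxE eqxx -/(s 2) in xi2; split.
  + by move=> j ji; have := xX j; rewrite !mxE (negbTE ji).
  + by rewrite /progress; case: sigma1 => ->; lra.
  + by move: L0; rewrite /progress; case: sigma1 => ->; lra.
- by rewrite /Tend lerD2r; have /andP[_ TL'] := TL; lra.
- by rewrite mulrAC ler_pM2r.
Qed.

(** Negation of the conclusion of [walk_exits], assumed for contradiction; its [2 ^+ A] matches the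
    extra [A] in the budget of [walk_within_level]. *)
Let no_exit := forall m x t, (2 <= m)%N -> in_tube m x -> L / 8 <= progress m x ->
  t0 <= t -> t + h m <= Tend ->
  Mn * H ^+ 4 * 2 ^+ A * mass x (slab (lev m)) t (h m) < W.

Let next_state m : no_exit -> (2 <= m)%N -> state m (H ^+ (2 ^ m)) ->
  state m.+1 (H ^+ (2 ^ m.+1)).
Proof.
move=> no m2 [x [t [xT t0t tT WW]]].
have W0 : 0 <= W by exact: mass_ge0.
(* The gain already stored in the invariant pays for the greatest possible displacement at this
   scale, which turns [no_exit] into the hypothesis of [walk_within_level]. *)
have twoH : 2 ^+ (A * 2 ^ m) <= H ^+ (2 ^ m) :> R.
  by rewrite -exprM ler_weXn2l ?ler1n// leq_mul2r leqnSn orbT.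
have [|x' [x'T _ x'W]] := walk_within_level m x t (N * 2 ^ m) xT.
  move=> x' t' x'T x'8 /andP[tt' t't].
  rewrite -(ltr_pM2l MnH0); apply: lt_le_trans WW.
  have V0 : Mn * H ^+ 4 * 2 ^+ A * mass x' (slab (lev m)) t' (h m) < W.
    apply: no => //; first exact: le_trans tt'.
    by move: tT; rewrite tauS; have := tau_ge0 m.+1; lra.
  apply: (@lt_le_trans _ _ (2 ^+ (A * 2 ^ m) * W)).
    by rewrite exprD -mulrA mulrCA ltr_pM2l ?exprn_gt0// mulrA.
  by rewrite mulrC ler_wpM2l.
set t1 := t + _ in x'W.
have hS : h m = kap^-1 * h m.+1.
  by rewrite !hE exprS; field; exact: lt0r_neq0.
have hSM : 0 < h m.+1 <= h m.
  by rewrite h0/= hS ler_peMl ?(ltW (h0 _))// invf_ge1//; move: kap2; lra.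
have hM : h m <= M%:R * h m.+1.
  by rewrite hS ler_pM2r// -[kap^-1]mul1r ler_pdivrMr.
have slabS j : slab (lev m) ord0 j = 2 * slab (lev m.+1) ord0 j.
  by rewrite !mxE levS; case: eqP => // _; rewrite mulrA.
have slab0 j : 0 < slab (lev m.+1) ord0 j.
  by rewrite mxE; case: eqP => _; rewrite ?lev0// divr_gt0.
have slabI j : 0 < slab (lev m.+1) ord0 j <= slab (lev m) ord0 j.
  by rewrite slabS slab0/=; have := slab0 j; lra.
have slabM j : slab (lev m) ord0 j <= M%:R * slab (lev m.+1) ord0 j.
  rewrite slabS ler_pM2r// ler_nat; apply: leq_trans MA.
  by rewrite (leq_trans _ (leq_mul (leqnn 4) A0)).
have [y [u [xy t1u ut1 WM]]] :=
  mass_subbox w w_weight x' (slab (lev m)) t1 (h m)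
  (slab (lev m.+1)) (h m.+1) M slabI slabM hSM hM.
exists y, u; split.
- exact: (in_tube_sub m x' y xy x'T).
- apply: le_trans t1u; apply: le_trans t0t _.
  by rewrite /t1 lerDl mulr_ge0// ltW.
- by apply: le_trans tT; rewrite (tauS m) addrACA [leRHS]addrA lerD2r.
set V := mass y _ _ _ in WM *.
(* [NM] raised to the power [2 ^ m]: the [N * 2 ^ m] doublings cover the displacement and the
   subdivision and leave [H ^+ (2 ^ m)]. *)
have gain : mass x (slab (lev m)) t (h m) * H ^+ (2 ^ m) <= V.
  have c0 : 0 < 2 ^+ (A * 2 ^ m) * Mn by rewrite mulr_gt0// exprn_gt0.
  rewrite -(ler_pM2l c0) mulrC -mulrA.
  apply: (@le_trans _ _ (2 ^+ (N * 2 ^ m) * mass x (slab (lev m)) t (h m))).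
    rewrite [leRHS]mulrC ler_wpM2l ?mass_ge0// !exprM.
    apply: (@le_trans _ _ ((2 ^+ A * Mn * H) ^+ (2 ^ m))); last first.
      by rewrite lerXn2r ?nnegrE ?exprn_ge0// ?mulr_ge0 ?exprn_ge0.
    rewrite !exprMn mulrC ler_pM2r//.
    rewrite ler_wpM2l ?exprn_ge0//.
    by rewrite -[leLHS]expr1 ler_weXn2l// expn_gt0.
  apply: le_trans x'W _; rewrite -mulrA ler_wpM2l ?exprn_ge0//.
(* The new gain equals the stored one, so the accumulated factor is squared. *)
rewrite expnS mul2n -addnn exprD mulrA.
apply: (@le_trans _ _ (Mn * H ^+ 4 * mass x (slab (lev m)) t (h m) * H ^+ (2 ^ m))).
  exact: (ler_wpM2r (ltW (H0 (2 ^ m))) WW).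
by rewrite -[leLHS]mulrA; exact: (ler_wpM2l (ltW MnH0) gain).
Qed.

Lemma walk_exits : 0 < W -> exists m x t,
  [/\ (2 <= m)%N, in_tube m x, L / 8 <= progress m x, t0 <= t /\ t + h m <= Tend &
    W <= Mn * H ^+ 4 * 2 ^+ A * mass x (slab (lev m)) t (h m)].
Proof.
move=> W0; apply: contrapT => nex.
have no : no_exit.
  move=> m x t m2 xT x8 t0t tT; rewrite ltNge; apply/negP => xW.
  by apply: nex; exists m, x, t.
have states m : state m.+2 (H ^+ (2 ^ m.+2)).
  by elim: m => [|m IH]; [exact: start_state|exact: next_state].
(* A fixed box containing the slabs of all states; its mass is finite, whereas the gain exceeds
   every [m]. *)
pose B := mass (X - const_mx L) (const_mx (4 * L)) t0 (Tend - t0).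
have bound m : W * m%:R <= Mn * H ^+ 4 * B.
  have [x [t [[xX px pL] t0t tT WW]]] := states m.
  apply: (@le_trans _ _ (W * H ^+ (2 ^ m.+2))).
    rewrite ler_pM2l// /H -exprM -natrX ler_nat.
    apply: leq_trans (ltnW (ltn_expl m (isT : (1 < 2)%N))) _.
    rewrite leq_exp2l// (leq_trans (ltnW (ltn_expl m (isT : (1 < 2)%N))))//.
    by rewrite (leq_trans _ (leq_pmull _ _))// leq_exp2l// -addn2 leq_addr.
  apply: le_trans WW _; rewrite ler_pM2l//.
  apply: (mass_le w w_weight) => //; last first.
    by rewrite subrKC; have := tau_ge0 m.+2; lra.
  move=> j; rewrite !mxE; have [->|ji] := eqVneq j i.
    rewrite -/(s _); have := s0 m.+2; move: px pL; rewrite /progress.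
    by move: L0; case: sigma1 => -> *; split; lra.
  have [? ?] := xX j ji; by move: L0; split; lra.
have := bound (Num.bound (Mn * H ^+ 4 * B / W)).
rewrite leNgt => /negP; apply.
have B0 : 0 <= Mn * H ^+ 4 * B / W.
  by rewrite divr_ge0 ?(ltW W0)// mulr_ge0 ?mass_ge0// ltW.
by rewrite [ltRHS]mulrC -ltr_pdivrMr//; exact: archi_boundP.
Qed.

End walk.

(** * Forward doubling *)

Section landing.
Context {R : realType} {n : nat} (w : spacetime R n -> R) (p k1 : R).
Hypotheses (w_weight : is_weight w) (k1_ge1 : 1 <= k1).
Implicit Types (c x e : 'rV[R]_n) (l t h : R).

Local Notation mass := (mass w).

Hypothesis doubling : forall l c t, 0 < l ->
  mass c (const_mx l) t (l `^ p) <= k1 * mass c (const_mx l) (t + l `^ p) (l `^ p).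

Lemma doubling_iter l c t (r : nat) : 0 < l ->
  mass c (const_mx l) t (l `^ p) <=
  k1 ^+ r * mass c (const_mx l) (t + r%:R * l `^ p) (l `^ p).
Proof.
move=> l0; elim: r => [|r IH]; first by rewrite mul0r addr0 expr0 mul1r.
apply: le_trans IH _; rewrite exprSr -mulrA ler_wpM2l ?exprn_ge0//.
  exact: le_trans k1_ge1.
apply: le_trans (doubling _ _ _ l0) _.
rewrite (_ : _ + _ + _ = t + r.+1%:R * l `^ p)//.
by rewrite -natr1 mulrDl mul1r addrA.
Qed.

(** The small box is enlarged to a cube of edge [l] inside the target cube, which then moves forward
    in time only. Since [2 * l^p <= T], one of its time intervals fits into the target. *)
Lemma landing l L c x e t h u T (rmax : nat) : 0 < l <= L ->
  (forall j, [/\ c ord0 j <= x ord0 j, e ord0 j <= l &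
     x ord0 j + e ord0 j <= c ord0 j + L]) ->
  h <= l `^ p -> t <= u -> 2 * l `^ p <= T ->
  (u - t) / l `^ p + 1 <= rmax%:R ->
  mass x e t h <= k1 ^+ rmax * mass c (const_mx L) u T.
Proof.
move=> /andP[l0 lL] xc hl tu lT ur.
have lp0 : 0 < l `^ p by exact: powR_gt0.
(* The cube starts at the corner of the small box, pulled back where it would leave the target. *)
pose y : 'rV[R]_n := \row_j Num.min (x ord0 j) (c ord0 j + L - l).
have yP j : [/\ c ord0 j <= y ord0 j, y ord0 j <= x ord0 j,
    x ord0 j + e ord0 j <= y ord0 j + l & y ord0 j + l <= c ord0 j + L].
  have [? ? ?] := xc j; rewrite mxE /Num.min.
  by case: ifPn => [?|]; [|rewrite -leNgt => ?]; split; lra.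
have q0 : 0 <= (u - t) / l `^ p by rewrite divr_ge0 ?subr_ge0// ltW.
(* After [r.+1] steps the interval starts at or after [u], by at most one length [l^p]. *)
have /andP[] := truncn_itv q0; set r := Num.trunc _ => rq qr.
have rl : r%:R * l `^ p <= u - t by rewrite -ler_pdivlMr.
have lr : u - t < r.+1%:R * l `^ p by rewrite -ltr_pdivrMr.
have r_max : (r.+1 <= rmax)%N by rewrite -(ler_nat R) -natr1; lra.
apply: (@le_trans _ _ (mass y (const_mx l) t (l `^ p))).
  apply: (mass_le w w_weight) => //; last by rewrite lerD2l.
  by move=> j; have [] := yP j; rewrite [const_mx _ _ _]mxE.
apply: le_trans (doubling_iter l y t r.+1 l0) _.
apply: ler_pM; rewrite ?mass_ge0 ?exprn_ge0//; first exact: le_trans k1_ge1.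
- by rewrite ler_weXn2l.
apply: (mass_le w w_weight); last by rewrite -natr1 in lr *; lra.
- by move=> j; rewrite !mxE; have [] := yP j; rewrite mxE => *; split; lra.
- by lra.
Qed.

End landing.

(** * Mass inequalities drawn from the reverse Hoelder condition *)

Section mass_reverse_holder.
Context {R : realType} {n : nat} (p k Lam : R) (q : \bar R).
Variable w : spacetime R n -> R.
Hypotheses (w_weight : is_weight w) (k0 : 0 <= k) (q1 : (1 < q)%E).
Hypothesis wk : (RHplus_const p q w <= k%:E)%E.

Local Notation mass := (mass w).

(** The whole box is taken as its own subset, with density 1 and splitting parameter 1. *)
Lemma mass_doubling (l k1 : R) (c : 'rV[R]_n) t : 0 < l ->
  k * rh_factor q 1 1 <= k1 ->
  mass c (const_mx l) t (l `^ p) <=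
  k1 * mass c (const_mx l) (t + l `^ p) (l `^ p).
Proof.
move=> l0 kk1; apply: (@le_trans _ _ (k * rh_factor q 1 1 *
    mass c (const_mx l) (t + l `^ p) (l `^ p))); last first.
  by rewrite ler_wpM2r// mass_ge0.
rewrite -lee_fin EFinM -!wint_box//.
apply: (wint_le_next p q w k w_weight k0 q1 wk) => //; first exact: measurable_box.
rewrite lebesgue_st_box ?(ltW (powR_gt0 _ l0))//; last first.
  by move=> j; rewrite mxE ltW.
by rewrite mul1r; under eq_bigr do rewrite mxE; rewrite prodr_const card_ord.
Qed.

Lemma mass_slab_gain (A : nat) (i : 'I_n) (l : R) (c x : 'rV[R]_n) t :
  0 < Lam -> k * rh_factor q Lam A%:R^-1 <= 4^-1 -> 0 < l ->
  (forall j, c ord0 j <= x ord0 j /\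
    x ord0 j + slab A i l ord0 j <= c ord0 j + l) ->
  4 * mass x (slab A i l) t (l `^ p) <=
  mass c (const_mx l) (t + l `^ p) (l `^ p).
Proof.
move=> Lam0 kA l0 cx; have lp0 : 0 <= l `^ p by exact: powR_ge0.
rewrite -ler_pdivlMl//; apply: (@le_trans _ _ (k * rh_factor q Lam A%:R^-1 *
    mass c (const_mx l) (t + l `^ p) (l `^ p))); last first.
  by rewrite ler_wpM2r// mass_ge0.
rewrite -lee_fin EFinM -!wint_box//.
apply: (wint_le_next p q w k w_weight k0 q1 wk) => //; first exact: measurable_box.
  move=> z [/= zx zt]; split => //= j.
  by have [? ?] := cx j; have /andP[? ?] := zx j; rewrite mxE; apply/andP; split; lra.
by rewrite lebesgue_slab// ltW.
Qed.

End mass_reverse_holder.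

(** * Choice of the constants and assembly *)

Theorem theorem2p5 (R : realType) (n : nat) (p : R) (q K : \bar R)
    (hp : 1 < p) (hq : (1 < q)%E) :
  exists nu Theta C : R,
    [/\ 0 < nu < 4^-1, 0 < Theta, 0 < C &
      forall w : spacetime R n -> R,
        RHplus p q w -> RHplus_const p q w = K ->
      forall gamma : R, 0 <= gamma <= 2^-1 ->
      forall (P : parabolic_rectangle R n) (i : 'I_n) (sigma : R),
        sigma = -1 \/ sigma = 1 ->
        (wint w (lower p gamma P) <=
         C%:E * wint w (translate (lower p gamma P)
                         ((sigma * nu * pedge P) *: delta_mx ord0 i,
                          Theta * pedge P `^ p)%R))%E].
Proof.
(* All constants are fixed from [K] before [w] appears. If [K] is [+oo], [fine] gives a dummy 0,
   harmless because no [w] then satisfies the hypotheses. *)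
pose k : R := Num.max 1 (fine K).
have k1 : 1 <= k by rewrite le_max lexx.
have k0 : 0 <= k by exact: le_trans k1.
have [A [Lam [kd [A0 Lam0 kd1 kkd kA]]]] := rh_factor_constants q k hq k1.
pose kap := half_powR p.
have kap0 : 0 < kap by exact: half_powR_gt0.
have kap2 : kap < 2^-1 by exact: half_powR_lt.
have kapk : 0 < kap ^+ 2 by rewrite exprn_gt0.
have kap4 : kap ^+ 2 <= 4^-1 by exact: half_powR_sqr_le.
have [M MA Mkap] : exists2 M : nat, (4 * A <= M)%N & 1 <= M%:R * kap ^+ 2.
  exists (4 * A + Num.bound (kap ^- 2))%N; first by rewrite leq_addr.
  rewrite -ler_pdivrMr// mul1r natrD ler_wpDl ?ler0n//.
  by rewrite ltW// archi_boundP// invr_ge0 ltW.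
have [N NM] : exists N, 2 ^+ A * M%:R ^+ n.+1 * 2 ^+ A.+1 <= 2 ^+ N :> R.
  by eexists; rewrite ltW// upper_nthrootP.
pose tau := N%:R * (2 * kap) ^+ 2 / (1 - 2 * kap).
have tau0 : 0 <= tau.
  rewrite divr_ge0 ?subr_ge0 ?mulr_ge0 ?exprn_ge0 ?mulr_ge0 ?(ltW kap0)//.
  by lra.
(* [tau] is the time from scale 2 onwards for [L = 1]; the translated rectangle thus begins exactly
   at the deadline [Tend] of the walk. *)
pose Theta := 1 + tau.
(* Bounds the number of doublings at edge [L / 4], whose time step is [kap ^+ 2] times [L^p]. *)
have [rmax hrmax] : exists rmax : nat, Theta / kap ^+ 2 + 1 <= rmax%:R.
  eexists; apply/ltW/archi_boundP; rewrite addr_ge0// divr_ge0 ?(ltW kapk)//.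
  exact: addr_ge0.
pose D := M%:R ^+ n.+1 * 2 ^+ A.+1 ^+ 4 * 2 ^+ A : R.
have M0 : 0 < M%:R :> R by rewrite ltr0n (leq_trans _ MA)// muln_gt0.
have D0 : 0 < D by rewrite !mulr_gt0 ?exprn_gt0.
(* The shift 1/8 is the exit threshold of the walk; [D] is the loss in [walk_exits] and [kd ^+ rmax]
   that of [landing]. *)
exists 8^-1, Theta, (D * kd ^+ rmax); split.
- by rewrite invr_gt0 ltr0n/= ltf_pV2 ?posrE ?ltr_nat.
- by rewrite /Theta; lra.
- by rewrite mulr_gt0// exprn_gt0// (lt_le_trans ltr01).
move=> w [w_weight wfin] wK gamma /andP[g0 g2] P i sigma sigma1.
have wk : (RHplus_const p q w <= k%:E)%E.
  move: wfin; rewrite wK /k; case: (K) => [r| |]//= _; last by rewrite leNye.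
  by rewrite lee_fin le_max lexx orbT.
rewrite lower_box translate_box !wint_box// -EFinM lee_fin /=.
set X := pcenter P - _; set L := pedge P; set T := (1 - gamma) * _.
set t0 := ptime P - _.
have L0 : 0 < L := pedge_gt0 P.
clearbody X L t0.
have Lp0 : 0 < L `^ p by exact: powR_gt0.
have TL : L `^ p / 2 <= T <= L `^ p 
  by rewrite /T; move: g0 g2 Lp0; clear; move=> *; apply/andP; split; nra.
(* The walk needs positive mass to grow; zero mass makes the claim trivial. *)
have [W0|W0] := leP (mass w X (const_mx L) t0 T) 0.
  apply: le_trans W0 _; rewrite mulr_ge0 ?mass_ge0// mulr_ge0 ?(ltW D0)// exprn_ge0//.
  exact: le_trans kd1.
have gain l c' x t :=
  mass_slab_gain p k Lam q w w_weight k0 hq wk A i l c' x t Lam0 kA.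
have [m [x [t [m2 [xX px pL] x8 [t0t tT] WD]]]] :=
  walk_exits w p w_weight hp A i sigma A0 sigma1 gain X L t0 L0 M N MA Mkap NM T TL W0.
apply: le_trans WD _; rewrite -/D -[leRHS]mulrA (ler_pM2l D0).
have dbl l c' t' (l0 : 0 < l) :=
  mass_doubling p k q w w_weight k0 hq wk l kd c' t' l0 kkd.
have powm : 2 ^+ 2 <= 2 ^+ m :> R by rewrite ler_weXn2l// ler1n.
have levm : L / 2 ^+ m <= L / 2 ^+ 2.
  by rewrite ler_pM2l// lef_pV2 ?posrE ?exprn_gt0.
have lev0 (j : nat) : 0 < L / 2 ^+ j by rewrite divr_gt0// exprn_gt0.
have lev2 : L / 2 ^+ 2 <= L.
  by rewrite ler_pdivrMr ?exprn_gt0// ler_peMr ?(ltW L0)// exprn_ege1// ler1n.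
have slevm : L / 2 ^+ m / A%:R <= L / 2 ^+ m.
  by rewrite ler_pdivrMr ?ltr0n// ler_peMr ?(ltW (lev0 m))// ler1n.
have h2 : (L / 2 ^+ 2) `^ p = L `^ p * kap ^+ 2 by rewrite powR_half// ltW.
have hm0 : 0 < (L / 2 ^+ m) `^ p by exact: powR_gt0.
have tauE : N%:R * L `^ p * (2 * kap) ^+ 2 / (1 - 2 * kap) = tau * L `^ p.
  by rewrite /tau; set v := (1 - 2 * kap)^-1; ring.
have tT' : t + (L / 2 ^+ m) `^ p <= t0 + Theta * L `^ p.
  by apply: le_trans tT _; rewrite /= tauE /Theta mulrDl mul1r addrA.
(* Whatever its scale, the exiting slab fits in a cube of edge [L / 4], so the number of doublings
   is bounded independently of [m]. *)
apply: (landing w p kd w_weight kd1 dbl (L / 2 ^+ 2)).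
- by rewrite lev0.
- move=> j; rewrite !mxE eqxx/=; have [->|ji] := eqVneq j i.
    move: px pL x8; rewrite /progress mulr1 => px pL x8.
    move: L0 px pL x8 levm lev2 slevm; clear -sigma1.
    by case: sigma1 => -> *; split; lra.
  by have [? ?] := xX j ji; rewrite mulr0 addr0; split => //; lra.
- by apply: ge0_ler_powR; rewrite ?nnegrE ?(ltW (lev0 _))//; lra.
- by lra.
- rewrite h2; have /andP[+ _] := TL; apply: le_trans.
  by rewrite mulrCA ler_pM2l//; lra.
- apply: le_trans hrmax; rewrite lerD2r h2.
  rewrite ler_pdivrMr ?mulr_gt0// mulrCA divfK ?gt_eqF//.
  by rewrite [leRHS]mulrC; lra.
Qed.
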